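(* Let $R_1$ and $R_2$ be commutative rings with identity $1\neq 0$ such that $|Z(R_2)|=2$. Then $\overline{\Gamma}(R_1\times R_2)$ is complemented if and only if $\overline{\Gamma}(R_1)$ is complemented and $R_1$ is reduced.
   Context: For a commutative ring $R$ with $1\neq 0$, $Z(R)$ is the set of zero-divisors of $R$ (including $0$) and $Z(R)^*=Z(R)\setminus\{0\}$. The extended zero-divisor graph $\overline{\Gamma}(R)$ is the simple graph with vertex set $Z(R)^*$ in which two distinct vertices $x,y$ are adjacent if and only if there exist positive integers $n,m$ with $x^ny^m=0$, $x^n\neq 0$ and $y^m\neq 0$. In a simple graph $G$, two vertices $u,v$ are orthogonal, written $u\perp v$, if they are adjacent and no vertex is adjacent to both of them. $G$ is complemented if for every vertex $v$ there is a vertex $u$ with $v\perp u$ (a condition that holds vacuously for the graph with no vertices). *)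

(* Defs.v *)
From mathcomp Require Import all_boot all_order all_algebra.
From mathcomp Require Import boolp classical_sets functions cardinality.

Set Implicit Arguments.
Unset Strict Implicit.
Unset Printing Implicit Defensive.

Import GRing.Theory.
Local Open Scope classical_set_scope.
Local Open Scope ring_scope.

Record simple_graph := SimpleGraph {
  vertex :> Type;
  adj : vertex -> vertex -> Prop;
  adj_sym : forall u v, adj u v -> adj v u;
  adj_irrefl : forall v, ~ adj v v }.

Definition orthogonal (G : simple_graph) (u v : G) : Prop :=
  adj u v /\ ~ exists w : G, adj w u /\ adj w v.

Definition complemented (G : simple_graph) : Prop :=
  forall v : G, exists u : G, orthogonal v u.

Definition zero_divisors (R : comNzRingType) : set R :=
  [set x | exists y : R, y <> 0 /\ x * y = 0].
Arguments zero_divisors : clear implicits.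

Definition reduced (R : comNzRingType) : Prop :=
  forall (x : R) (n : nat), x ^+ n = 0 -> x = 0.

Section ExtendedZeroDivisorGraph.
Variable R : comNzRingType.

Definition ezd_vertex := set_type (zero_divisors R `\ 0).

Definition ezd_adj (x y : ezd_vertex) : Prop :=
  x <> y /\
  exists n m : nat, [/\ (0 < n)%N, (0 < m)%N,
    val x ^+ n * val y ^+ m = 0, val x ^+ n <> 0 & val y ^+ m <> 0].

Lemma ezd_adj_sym x y : ezd_adj x y -> ezd_adj y x.
Proof.
move=> [xy [n [m [n0 m0 xy0 xn ym]]]]; split; first by exact/nesym.
by exists m, n; split=> //; rewrite mulrC.
Qed.

Lemma ezd_adj_irrefl x : ~ ezd_adj x x.
Proof. by case. Qed.

Definition extended_zero_divisor_graph : simple_graph :=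
  SimpleGraph ezd_adj_sym ezd_adj_irrefl.

End ExtendedZeroDivisorGraph.

(* Main.v *)
Require Import Defs.
From mathcomp Require Import all_boot all_order all_algebra.
From mathcomp Require Import boolp classical_sets functions cardinality.

(** If [Z(R2) = {0, a}] then [a^2 = 0].  When [x != 0] and [x^2 = 0] in [R1], the
    vertex [(x, a)] has no orthogonal: a neighbour [(p, q)] has [q] in [{0, a}],
    so [(0, a)] is a common neighbour, unless [(p, q) = (0, a)], and then [(x, 0)]
    is one.  Once [R1] is reduced, its graph is complemented iff every [x] has
    an [x'] with [x * x' = 0] and [ann(x) /\ ann(x') = 0].  Such an [x'] is read off
    an orthogonal of [(x, 1)].  Conversely [(x, y)] is orthogonal to [(x', 0)] if
    [y] is regular, to [(x', 1)] if [y] is a zero-divisor and [x != 0], and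
    [(0, a)] is orthogonal to [(1, 0)]. *)

Set Implicit Arguments.
Unset Strict Implicit.

Local Open Scope classical_set_scope.
Local Open Scope card_scope.

Import GRing.Theory.
Local Open Scope ring_scope.

(** * Adjacency and orthogonality on bare ring elements *)

Definition ezd_rel (R : comNzRingType) (x y : R) : Prop :=
  x <> y /\
  exists n m : nat, [/\ (0 < n)%N, (0 < m)%N,
    x ^+ n * y ^+ m = 0, x ^+ n <> 0 & y ^+ m <> 0].

Lemma expr_neq0 (R : comNzRingType) (x : R) (n : nat) :
  (0 < n)%N -> x ^+ n <> 0 -> x <> 0.
Proof. by case: n => // n _ + x0; rewrite x0 expr0n. Qed.

Lemma ezd_rel_mul (R : comNzRingType) (x y : R) :
  x <> y -> x * y = 0 -> x <> 0 -> y <> 0 -> ezd_rel x y.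
Proof. by move=> xy xy0 x0 y0; split=> //; exists 1%N, 1%N; rewrite !expr1. Qed.

Lemma ezd_rel_sym (R : comNzRingType) (x y : R) : ezd_rel x y -> ezd_rel y x.
Proof.
move=> [xy [n [m [n0 m0 xy0 xn ym]]]]; split; first exact/nesym.
by exists m, n; split=> //; rewrite mulrC.
Qed.

(** The last nonzero element among [z], [x * z], [x ^+ 2 * z], ... is killed by [x]. *)
Lemma zero_divisors_exp (R : comNzRingType) (x z : R) (n : nat) :
  x ^+ n * z = 0 -> z <> 0 -> zero_divisors R x.
Proof.
move=> + z0; elim: n => [|n IH]; first by rewrite expr0 mul1r.
have [/IH//|xnz] := pselect (x ^+ n * z = 0).
by rewrite exprS -mulrA => xxnz; exists (x ^+ n * z).
Qed.

Lemma regular_exp (R : comNzRingType) (x z : R) (n : nat) :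
  ~ zero_divisors R x -> z * x ^+ n = 0 -> z = 0.
Proof.
move=> xreg; rewrite mulrC => xz0; apply: contrapT => z0.
exact/xreg/(zero_divisors_exp xz0 z0).
Qed.

Lemma ezd_rel_vertex (R : comNzRingType) (x y : R) :
  ezd_rel x y -> zero_divisors R x /\ x <> 0.
Proof.
move=> [_ [n [m [n0 _ xy0 xn ym]]]]; split; last exact: expr_neq0 xn.
exact: zero_divisors_exp xy0 ym.
Qed.

(** By [ezd_rel_vertex], adjacency already forces both ends to be nonzero zero-divisors, so [y] and
    [w] can range over all of [R] without membership proofs. *)
Lemma complemented_ezdP (R : comNzRingType) :
  complemented (extended_zero_divisor_graph R) <->
  forall x : R, zero_divisors R x -> x <> 0 ->
  exists2 y, ezd_rel x y & forall w, ezd_rel w x -> ~ ezd_rel w y.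
Proof.
have adjE (u v : ezd_vertex R) : ezd_adj u v <-> ezd_rel (val u) (val v).
  split=> -[uv e]; split=> //; first by move/val_inj.
  by move=> uv'; apply: uv; rewrite uv'.
have vertexP x : zero_divisors R x -> x <> 0 -> exists v : ezd_vertex R, val v = x.
  by move=> xZ x0; exists (exist _ x (mem_set (conj xZ x0))).
split=> [cG x xZ x0|cR v].
  have [v vx] := vertexP _ xZ x0.
  have [u [/adjE]] := cG v; rewrite vx => xu nou; exists (val u) => // w wx wu.
  have [wZ w0] := ezd_rel_vertex wx.
  have [s sw] := vertexP _ wZ w0.
  by apply: nou; exists s; split; apply/adjE; rewrite ?vx sw.
have [vZ v0] := set_valP v.
have [y vy noy] := cR _ vZ v0.
have [yZ y0] := ezd_rel_vertex (ezd_rel_sym vy).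
have [u uy] := vertexP _ yZ y0.
exists u; split; first by apply/adjE; rewrite uy.
by move=> [w [/adjE wv /adjE]]; rewrite uy; exact: noy.
Qed.

(** * Reduced rings *)

(** As [n <= 2 ^ n], also [x ^+ (2 ^ n) = 0]; the exponent is then halved down to 1. *)
Lemma reduced_sqr (R : comNzRingType) :
  (forall x : R, x * x = 0 -> x = 0) -> reduced R.
Proof.
move=> sqr x n xn0.
have : x ^+ (2 ^ n) = 0.
  by rewrite -(subnKC (ltnW (ltn_expl n (isT : 1 < 2)%N))) exprD xn0 mul0r.
elim: n {xn0} => [|n IH]; first by rewrite expr1.
by rewrite expnSr exprM expr2 => /sqr.
Qed.

Lemma reduced_exprM (R : comNzRingType) (x y : R) (n m : nat) :
  reduced R -> x ^+ n * y ^+ m = 0 -> x * y = 0.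
Proof.
move=> redR xy0; apply: (redR _ (n + m)%N).
by rewrite exprMn exprD [(n + m)%N]addnC exprD mulrACA xy0 mul0r.
Qed.

Lemma reduced_ezd_rel (R : comNzRingType) (x y : R) :
  reduced R -> x * y = 0 -> x <> 0 -> y <> 0 -> ezd_rel x y.
Proof.
move=> redR xy0 x0 y0; apply: ezd_rel_mul => // xy.
by apply/x0/(redR _ 2%N); rewrite expr2 {2}xy.
Qed.

(** The right-hand side also covers the non-vertices, a regular [x] with [x' = 0] and [x = 0] with
    [x' = 1], since any element can be a first coordinate of a vertex of the product. *)
Lemma reduced_complementedP (R : comNzRingType) : reduced R ->
  complemented (extended_zero_divisor_graph R) <->
  forall x : R, exists2 x', x * x' = 0 &
    forall p, p * x = 0 -> p * x' = 0 -> p = 0.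
Proof.
move=> redR; split=> [/complemented_ezdP cR x|cR].
  have [xZ|xreg] := pselect (zero_divisors R x); last first.
    exists 0; rewrite ?mulr0 // => p px _.
    by apply: (@regular_exp _ x p 1); rewrite ?expr1.
  have [->|x0] := pselect (x = 0).
    by exists 1; rewrite ?mul0r // => p _; rewrite mulr1.
  have [x' xx' nox] := cR _ xZ x0.
  have [_ x'0] := ezd_rel_vertex (ezd_rel_sym xx').
  have [_ [n [m [_ _ /reduced_exprM-/(_ redR) xx'0 _ _]]]] := xx'.
  exists x' => // p px px'; apply: contrapT => p0.
  exact: (nox p (reduced_ezd_rel redR px p0 x0) (reduced_ezd_rel redR px' p0 x'0)).
apply/complemented_ezdP => x [z [z0 xz0]] x0.
have [x' xx' annx] := cR x.
have x'0 : x' <> 0.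
  by move=> e; apply/z0/annx; rewrite ?e ?mulr0 // mulrC.
exists x'; first exact: reduced_ezd_rel.
move=> p px [_ [n [m [_ _ /reduced_exprM-/(_ redR) px'0 _ _]]]].
have [_ p0] := ezd_rel_vertex px.
have [_ [k [l [_ _ /reduced_exprM-/(_ redR) px0 _ _]]]] := px.
exact/p0/annx.
Qed.

(** * Rings with exactly two zero-divisors *)

Lemma zero_divisors_two (R : comNzRingType) : zero_divisors R #= `I_2 ->
  exists a : R, [/\ a <> 0, a * a = 0 &
    forall y, zero_divisors R y -> y = 0 \/ y = a].
Proof.
move=> /card_set_bijP[f [fI finj fsurj]].
have Z0 : zero_divisors R 0 by exists 1; split; [exact/eqP/oner_neq0|rewrite mul0r].
have [b Zb b0] : exists2 b, zero_divisors R b & b <> 0.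
  have [[u Zu fu] [v Zv fv]] := (fsurj 0%N isT, fsurj 1%N isT).
  have [u0|] := pselect (u = 0); last by exists u.
  by exists v => // v0; move: fv; rewrite v0 -u0 fu.
have Zab y : zero_divisors R y -> y = 0 \/ y = b.
  move=> Zy; have [y0|y0] := pselect (y = 0); [by left|right].
  have inj u v : zero_divisors R u -> zero_divisors R v -> f u = f v -> u = v.
    by move=> Zu Zv; apply: finj; exact: mem_set.
  have := fI _ Z0; have := fI _ Zb; have := fI _ Zy; rewrite /=.
  have := inj _ _ Zy Zb; have := inj _ _ Zy Z0; have := inj _ _ Zb Z0.
  (* Pigeonhole: two of the three values in [I_2] agree, and only [f y = f b] is compatible with [y]
     and [b] being nonzero. *)
  by case: (f y) (f b) (f 0) => [|[|?]] [|[|?]] [|[|?]] // A B C _ _ _;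
    rewrite ?C //; [case: y0; exact: B|case: b0; exact: A|
                    case: b0; exact: A|case: y0; exact: B].
exists b; split=> //.
(* A nonzero [z] killing [b] is itself a zero-divisor, hence equals [b]. *)
have [z [z0 bz0]] := Zb.
have [|//|zb] := Zab z; last by rewrite -{2}zb.
by exists b; rewrite mulrC.
Qed.

(** * The graph of the product *)

Section Product.
Variables R1 R2 : comNzRingType.
Implicit Types (x p : R1) (y q : R2).

Lemma pairX x y n : ((x, y) : R1 * R2) ^+ n = (x ^+ n, y ^+ n).
Proof. by elim: n => // n IH; rewrite !exprS IH. Qed.

Lemma pair_neq0l x y : x <> 0 -> ((x, y) : R1 * R2) <> 0.
Proof. by move=> x0 [/x0]. Qed.

Lemma pair_neq0r x y : y <> 0 -> ((x, y) : R1 * R2) <> 0.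
Proof. by move=> y0 [_ /y0]. Qed.

Lemma ezd_rel_pair x y p q :
  @ezd_rel (R1 * R2)%type (x, y) (p, q) -> exists n m : nat,
  [/\ (0 < n)%N /\ (0 < m)%N, x ^+ n * p ^+ m = 0, y ^+ n * q ^+ m = 0,
      x ^+ n = 0 -> y ^+ n <> 0 & p ^+ m = 0 -> q ^+ m <> 0].
Proof.
move=> [_ [n [m []]]]; rewrite !pairX => n0 m0 [xp yq] xy pq.
by exists n, m; split=> // e e'; [apply: xy|apply: pq]; rewrite e e'.
Qed.

Variable a : R2.
Hypotheses (a0 : a <> 0) (aa0 : a * a = 0)
  (Za : forall y, zero_divisors R2 y -> y = 0 \/ y = a).

Let one1 : 1 <> 0 :> R1. Proof. exact/eqP/oner_neq0. Qed.
Let one2 : 1 <> 0 :> R2. Proof. exact/eqP/oner_neq0. Qed.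

Lemma complemented_product_reduced :
  complemented (extended_zero_divisor_graph (R1 * R2)%type) -> reduced R1.
Proof.
move=> /complemented_ezdP cR; apply: reduced_sqr => x xx0.
apply: contrapT => x0.
have xa0 : ((x, a) : R1 * R2) <> 0 by exact: pair_neq0l.
have [|[p q] xapq no] := cR (x, a) _ xa0.
  by exists (x, a); split=> //; congr pair.
have [_ pq0] := ezd_rel_vertex (ezd_rel_sym xapq).
have aq0 : a * q = 0.
  have [n [m [[n0 _] _ aq0 xa _]]] := ezd_rel_pair xapq.
  (* The square of [(x, a)] is zero, so its exponent in the adjacency is 1. Then [q ^+ m] kills [a],
     which puts [q] in [{0, a}]. *)
  have {xa} : (n < 2)%N.
    rewrite ltnNge; apply/negP => /subnKC ne; move: xa.
    by rewrite -ne !exprD !expr2 xx0 aa0 !mul0r; exact.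
  case: n n0 aq0 => [|[|//]] // _; rewrite expr1 mulrC => qa0 _.
  by have [|->|->] := Za (y := q); rewrite ?mulr0 //; exact: zero_divisors_exp qa0 a0.
have [xpq|xpq] := pselect ((p, q) = (0, a) :> R1 * R2).
  apply: (no (x, 0)).
    apply: ezd_rel_mul; try exact: pair_neq0l.
      by case=> /esym.
    by congr pair; rewrite ?mul0r.
  rewrite xpq; apply: ezd_rel_mul; try exact: pair_neq0l; try exact: pair_neq0r.
    by case.
  by congr pair; rewrite ?mulr0 ?mul0r.
apply: (no (0, a)).
  apply: ezd_rel_mul => //; first by case=> /esym.
    by congr pair; rewrite ?mul0r.
  exact: pair_neq0r.
apply: ezd_rel_mul => //; first by move/esym.
  by congr pair; rewrite ?mul0r.
exact: pair_neq0r.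
Qed.

Lemma complemented_product_fst :
  complemented (extended_zero_divisor_graph (R1 * R2)%type) -> reduced R1 ->
  complemented (extended_zero_divisor_graph R1).
Proof.
move=> /complemented_ezdP cR redR; apply/reduced_complementedP => // x.
have [[z [z0 xz0]]|xreg] := pselect (zero_divisors R1 x); last first.
  exists 0; rewrite ?mulr0 // => p px _.
  by apply: (@regular_exp _ x p 1); rewrite ?expr1.
have [|[p q] xpq no] := cR (x, 1) _ (pair_neq0r one2).
  by exists (z, 0); split; [exact: pair_neq0l|congr pair; rewrite ?mulr0].
have [_ pq0] := ezd_rel_vertex (ezd_rel_sym xpq).
have [n [m [[_ m0] xp + _ +]]] := ezd_rel_pair xpq.
(* The second coordinate 1 forces [q ^+ m = 0], so [p ^+ m] must be nonzero. *)
rewrite expr1n mul1r => qm0 pm; have {pm} p0 : p <> 0.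
  by apply: (expr_neq0 m0) => /pm.
exists p; first exact: reduced_exprM xp.
move=> w wx wp; apply: contrapT => w0; apply: (no (w, 0)).
  apply: ezd_rel_mul; try exact: pair_neq0l; try exact: pair_neq0r.
    by case=> _ /esym.
  by congr pair; rewrite ?mul0r.
apply: ezd_rel_mul => //; last exact: pair_neq0l.
  (* Distinctness needs [R1] reduced: [w = p] would give [p ^+ 2 = w * p = 0]. *)
  by case=> wp' _; apply: p0; apply: (redR _ 2%N); rewrite expr2 -{1}wp'.
by congr pair; rewrite ?mul0r.
Qed.

Lemma complemented_product :
  complemented (extended_zero_divisor_graph R1) -> reduced R1 ->
  complemented (extended_zero_divisor_graph (R1 * R2)%type).
Proof.
move=> cR redR; have {cR} annR := (reduced_complementedP redR).1 cR.
apply/complemented_ezdP => -[x y] [[s t] [st0 [xs0 yt0]]] xy0.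
have [x' xx' annx] := annR x.
have [yZ|yreg] := pselect (zero_divisors R2 y); last first.
  have t0 : t = 0 by apply: (@regular_exp _ y t 1); rewrite // expr1 mulrC.
  have x'0 : x' <> 0.
    move=> x'0; apply: st0; congr pair => //.
    by apply: annx; rewrite ?x'0 ?mulr0 // mulrC.
  exists (x', 0).
    apply: ezd_rel_mul => //; last exact: pair_neq0l.
      by case=> _ y0; apply: yreg; exists 1; rewrite y0 mul0r.
    by congr pair; rewrite ?mulr0.
  move=> [p q] /ezd_rel_pair [n [m [[n0 _] px qy pq _]]].
  move=> /ezd_rel_pair [k [l [_ px' _ _ _]]].
  (* Regularity of [y] kills [q ^+ n], so a common neighbour has [p <> 0], although [p] annihilates
     both [x] and [x']. *)
  have qn0 := regular_exp yreg qy.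
  apply: (@expr_neq0 _ p n) => //; first by move/pq; exact.
  by apply: annx; [exact: reduced_exprM px|exact: reduced_exprM px'].
have yy0 : y * y = 0 by have [//|->|->] := Za (y := y); rewrite ?mul0r.
have [x0|x0] := pselect (x = 0).
  have ya : y = a.
    by have [//|y0|//] := Za (y := y); case: xy0; rewrite x0 y0.
  rewrite {}x0 {}ya in xy0 *.
  exists (1, 0).
    apply: ezd_rel_mul => //; last exact: pair_neq0l.
      by case=> /esym.
    by congr pair; rewrite ?mulr0 ?mul0r.
  (* Adjacency to [(1, 0)] makes [p] nilpotent, so [p = 0]. Adjacency to [(0, a)] then puts [q] in
     [{0, a}]: [q = 0] has no nonzero power, and [q = a] gives the vertex [(0, a)] itself. *)
  move=> [p q] pqa /ezd_rel_pair [k [l [_ + _ _ _]]].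
  rewrite expr1n mulr1 => /redR p0; rewrite {}p0 in pqa *.
  have [pq _] := pqa.
  have [n [m [[n0 m0] _ qa q0]]] := ezd_rel_pair pqa.
  rewrite !expr0n !gtn_eqF //= in q0 *.
  have {q0}qn0 := q0 erefl; move=> /(_ erefl) am0.
  have {am0}m1 : m = 1%N.
    by case: m m0 am0 {qa} => [|[|m]] // _; rewrite !exprS mulrA aa0 mul0r.
  rewrite m1 expr1 in qa.
  have [|q0|qa'] := Za (y := q); first exact: zero_divisors_exp qa a0.
    exact: (expr_neq0 n0 qn0).
  by apply: pq; rewrite qa'.
exists (x', 1).
  split.
    by case=> _ y1; apply: one2; rewrite -[1]mulr1 -y1.
  (* The plain product is [(0, y)], possibly nonzero. Squaring [(x, y)] removes [y], while [x ^+ 2]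
     survives because [R1] is reduced. *)
  exists 2%N, 1%N; split=> //.
  - by rewrite !pairX !expr2 !expr1; congr pair; rewrite ?mulr1 // -mulrA xx' mulr0.
  - by rewrite pairX; apply: pair_neq0l => /redR.
  - exact: pair_neq0r.
move=> [p q] /ezd_rel_pair [n [m [_ px _ _ _]]].
move=> /ezd_rel_pair [k [l [[k0 _] px' + pq _]]].
(* Here the coordinate 1 of [(x', 1)] forces [q ^+ k = 0], hence again [p <> 0]. *)
rewrite expr1n mulr1 => qk0.
apply: (@expr_neq0 _ p k) => //; first by move/pq; exact.
by apply: annx; [exact: reduced_exprM px|exact: reduced_exprM px'].
Qed.

End Product.

Unset Implicit Arguments.

Theorem theorem5p2 (R1 R2 : comNzRingType) (hR2 : zero_divisors R2 #= `I_2) :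
  complemented (extended_zero_divisor_graph (R1 * R2)%type) <->
  complemented (extended_zero_divisor_graph R1) /\ reduced R1.
Proof.
have [a [a0 aa0 Za]] := zero_divisors_two hR2.
split=> [cR|[cR redR]]; last exact: complemented_product a0 aa0 Za cR redR.
have redR := complemented_product_reduced a0 aa0 Za cR.
by split=> //; exact: complemented_product_fst cR redR.
Qed.
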